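(* Let $\ell>1$ be an even integer. For all positive integers $n$, \[ b_{\ell}^e(n)-b_{\ell}^o(n)=(-1)^n d_{\ell}(n), \] where $b_{\ell}^e(n)$ (resp. $b_{\ell}^o(n)$) is the number of $\ell$-regular partitions of $n$ into an even (resp. odd) number of parts, and $d_{\ell}(n)$ is the number of partitions of $n$ into distinct parts each of which is congruent to one of $0,1,3,\dots,\ell-3,\ell-1$ modulo $\ell$.
   Context: A partition of a positive integer $n$ is a finite nonincreasing sequence of positive integers summing to $n$; its entries are its parts. For an integer $\ell>1$, a partition is called $\ell$-regular if none of its parts is divisible by $\ell$. *)

(* Defs.v *)
From HB Require Import structures.
From mathcomp Require Import all_boot.

Set Implicit Arguments.
Unset Strict Implicit.
Unset Printing Implicit Defensive.

Definition is_intpart (n : nat) (s : seq nat) : bool :=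
  [&& sorted geq s, all (fun x => 0 < x) s & sumn s == n].

Record intpart (n : nat) : Type := IntPart {
  parts :> seq nat;
  _ : is_intpart n parts
}.

HB.instance Definition _ n := [isSub for @parts n].
HB.instance Definition _ n := [Countable of intpart n by <:].

Lemma intpart_part_le n s x : is_intpart n s -> x \in s -> x <= n.
Proof.
case/and3P=> _ _ /eqP <-; elim: s => //= y s IHs.
rewrite inE => /predU1P[->|/IHs xs]; first exact: leq_addr.
exact: leq_trans xs (leq_addl _ _).
Qed.

Lemma intpart_size_le n s : is_intpart n s -> size s <= n.
Proof.
case/and3P=> _ s_gt0 /eqP <-; elim: s s_gt0 => //= y s IHs /andP[y_gt0 /IHs].
by move=> les; rewrite -add1n leq_add.
Qed.

(* A partition of n is a sequence of length at most n with entries at most n;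
   this embedding is only used to make the type of partitions finite. *)
Definition intpart_encode n (p : intpart n) : n.-bseq 'I_n.+1 :=
  insub_bseq n (map inord p).
Definition intpart_decode n (b : n.-bseq 'I_n.+1) : option (intpart n) :=
  insub (map val b).

Lemma intpart_encodeK n : pcancel (@intpart_encode n) (@intpart_decode n).
Proof.
case=> s s_part; rewrite /intpart_decode /intpart_encode /=.
rewrite /insub_bseq val_insubd ifT; last by rewrite size_map (intpart_size_le s_part).
rewrite -map_comp (_ : map _ _ = s); first by rewrite insubT.
rewrite -[RHS]map_id; apply/eq_in_map => x xs /=.
by rewrite inordK // ltnS (intpart_part_le s_part).
Qed.

HB.instance Definition _ n :=
  isFinite.Build (intpart n) (pcan_enumP (@intpart_encodeK n)).

Definition l_regular (l : nat) (s : seq nat) : bool :=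
  all (fun x => ~~ (l %| x)) s.

Definition b_even (l n : nat) : nat :=
  #|[set p : intpart n | l_regular l p && ~~ odd (size p)]|.

Definition b_odd (l n : nat) : nat :=
  #|[set p : intpart n | l_regular l p && odd (size p)]|.

(* For even l this is the list 0, 1, 3, ..., l - 3, l - 1. *)
Definition residues (l : nat) : seq nat := 0 :: [seq i <- iota 0 l | odd i].

Definition d_distinct (l n : nat) : nat :=
  #|[set p : intpart n | uniq p & all (fun x => x %% l \in residues l) p]|.

(* Main.v *)
(* The signed count of l-regular partitions has generating function
   prod_{l does not divide k} 1/(1 + q^k) = prod_k (1 + q^(lk)) / prod_k (1 + q^k).
   By Euler, 1 / prod_k (1 + q^k) = prod_{k odd} (1 - q^k), which yields
   prod_k (1 + q^(lk)) * prod_{k odd} (1 - q^k). As l is even, substituting -q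
   for q makes all signs positive, and the product then counts the partitions
   into distinct parts that are odd or divisible by l. *)
Require Import Defs.
From mathcomp Require Import all_boot all_order all_algebra.
From mathcomp Require Import ring.
Import GRing.Theory Num.Theory.
Local Open Scope ring_scope.

(** * Partitions of [n] as multiplicity functions *)

Section Multiplicities.
Variable n : nat.
Local Open Scope nat_scope.

(** Index [i] stands for the part size [i.+1], so the sizes run from 1 to [n]. *)
Definition seq_of_mults (f : 'I_n -> nat) : seq nat :=
  flatten [seq nseq (f i) i.+1 | i <- enum 'I_n].

Lemma count_seq_of_mults (f : 'I_n -> nat) (a : pred nat) :
  count a (seq_of_mults f) = \sum_(i < n) a i.+1 * f i.
Proof.
rewrite /seq_of_mults count_flatten -map_comp sumnE big_map big_enum /=.
by apply: eq_bigr => i _; rewrite count_nseq.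
Qed.

Lemma count_mem_seq_of_mults (f : 'I_n -> nat) (i : 'I_n) :
  count_mem i.+1 (seq_of_mults f) = f i.
Proof.
rewrite count_seq_of_mults (bigD1 i) //= eqxx mul1n big1 ?addn0 // => j /negbTE ji.
by rewrite eqSS val_eqE ji.
Qed.

Lemma sumn_seq_of_mults (f : 'I_n -> nat) :
  sumn (seq_of_mults f) = \sum_(i < n) i.+1 * f i.
Proof.
rewrite sumn_flatten -map_comp sumnE big_map big_enum /=.
by apply: eq_bigr => i _; rewrite sumn_nseq.
Qed.

Lemma seq_of_mults_gt0 (f : 'I_n -> nat) : all (ltn 0) (seq_of_mults f).
Proof.
by apply/allP => x /flatten_mapP[i _]; rewrite mem_nseq => /andP[_ /eqP->].
Qed.

Lemma intpart_bounds (p : intpart n) x : x \in (p : seq nat) -> 0 < x <= n.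
Proof.
move=> xp; rewrite (intpart_part_le (valP p) xp) andbT.
by case/and3P: (valP p) => _ /allP/(_ _ xp).
Qed.

Lemma perm_seq_of_mults (p : intpart n) :
  perm_eq p (seq_of_mults (fun i => count_mem i.+1 p)).
Proof.
apply/permP => a; rewrite count_seq_of_mults.
have := @intpart_bounds p; elim: (p : seq nat) => [|x s IHs] bnd /=.
  by rewrite big1 // => i _; rewrite muln0.
rewrite IHs => [|y ys]; last by apply: bnd; rewrite inE ys orbT.
under [RHS]eq_bigr do rewrite mulnDr.
rewrite big_split /=; congr (_ + _).
have /andP[x_gt0 x_le] := bnd x (mem_head _ _).
have ltx : x.-1 < n by rewrite prednK.
rewrite (bigD1 (Ordinal ltx)) //= prednK // eqxx muln1 big1 ?addn0 // => i.
rewrite -val_eqE /= => ix; case: eqP => [xi|_]; last by rewrite muln0.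
by rewrite xi eqxx in ix.
Qed.

(** A partition of [n] has at most [n] parts, so [inord] truncates nothing; the finite codomain
    matches the expansion of a product of finite sums. *)
Definition mults (p : intpart n) : {ffun 'I_n -> 'I_n.+1} :=
  [ffun i : 'I_n => inord (count_mem i.+1 p)].

Lemma multsE (p : intpart n) (i : 'I_n) : mults p i = count_mem i.+1 p :> nat.
Proof.
rewrite ffunE inordK // ltnS; apply: leq_trans (count_size _ _) _.
exact: intpart_size_le (valP p).
Qed.

Lemma mults_inj : injective mults.
Proof.
move=> p q eqpq; apply: val_inj; apply: (sorted_eq (leT := geq)).
- by move=> y x z /= xy yz; apply: leq_trans yz xy.
- by move=> x y /= ?; apply/eqP; rewrite eqn_leq andbC.
- by case/and3P: (valP p).
- by case/and3P: (valP q).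
rewrite (perm_trans (perm_seq_of_mults p)) // perm_sym.
rewrite (perm_trans (perm_seq_of_mults q)) //.
suff -> : seq_of_mults (fun i => count_mem i.+1 q) =
          seq_of_mults (fun i => count_mem i.+1 p) by [].
by congr flatten; apply: eq_map => i; rewrite -!multsE eqpq.
Qed.

(** Sorting [seq_of_mults f] gives a preimage of any [f] of total weight [n]. *)
Lemma mults_image :
  [set mults p | p : intpart n] = [set f : {ffun 'I_n -> 'I_n.+1} | \sum_(i < n) i.+1 * f i == n].
Proof.
apply/setP => f; rewrite inE; apply/imsetP/eqP => [[p _ ->]|fn].
  under eq_bigr do rewrite multsE.
  rewrite -sumn_seq_of_mults -(perm_sumn (perm_seq_of_mults p)).
  by case/and3P: (valP p) => _ _ /eqP.
pose g (i : 'I_n) : nat := f i.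
pose s := sort geq (seq_of_mults g).
have ps : perm_eq s (seq_of_mults g) by rewrite perm_sort.
have s_part : is_intpart n s.
  apply/and3P; split.
  - by apply: sort_sorted => x y /=; apply: leq_total.
  - by rewrite (perm_all _ ps) seq_of_mults_gt0.
  - by rewrite (perm_sumn ps) sumn_seq_of_mults fn.
exists (IntPart s_part) => //; apply/ffunP => i; apply: val_inj.
by rewrite /= multsE /= (permP ps) count_mem_seq_of_mults.
Qed.

End Multiplicities.

Arguments mults {n}.
Arguments mults_inj {n}.

(** * Signed partition counts as coefficients of polynomial products *)

(** Expanding the product chooses a multiplicity for each part size, and the exponent is the sum of
    the chosen parts. The choices with exponent [n] are exactly the partitions of [n]. *)
Lemma sum_intpart_coef (R : comNzRingType) (n : nat) (w : nat -> nat -> R) :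
  \sum_(p : intpart n) \prod_(i < n) w i.+1 (count_mem i.+1 p) =
  (\prod_(i < n) \sum_(j < n.+1) w i.+1 j *: 'X^(i.+1 * j))`_n.
Proof.
rewrite bigA_distr_bigA coef_sum /=.
transitivity (\sum_(p : intpart n) \prod_(i < n) w i.+1 (mults p i)).
  by apply: eq_bigr => p _; apply: eq_bigr => i _; rewrite multsE.
rewrite -(big_imset (fun f : {ffun 'I_n -> 'I_n.+1} => \prod_(i < n) w i.+1 (f i)))
  /=; last by move=> p q _ _; apply: mults_inj.
under eq_bigl do rewrite mults_image inE.
rewrite big_mkcond; apply: eq_bigr => f _.
by rewrite scaler_prod prodrXr coefZ coefXn eq_sym mulr_natr mulrb.
Qed.

Lemma prod_sign_bool (n : nat) (e : 'I_n -> nat) (b : 'I_n -> bool) :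
  \prod_(i < n) ((-1) ^+ e i * (b i)%:R) =
  (-1) ^+ (\sum_(i < n) e i)%N * ([forall i, b i])%:R :> int.
Proof.
rewrite big_split /= prodrXr; congr (_ * _).
case: forallP => [b1|/forallP]; first by rewrite big1 // => i _; rewrite b1.
by rewrite negb_forall => /existsP[i /negbTE bi]; rewrite (bigD1 i) //= bi mul0r.
Qed.

Lemma forall_count_mem (n : nat) (p : intpart n) (a : pred nat) :
  [forall i : 'I_n, (count_mem i.+1 p == 0%N) || a i.+1] = all a p.
Proof.
apply/forallP/allP => [pa x xp|pa i].
  have /andP[x_gt0 x_le] := intpart_bounds _ _ _ xp.
  have ltx : (x.-1 < n)%N by rewrite prednK.
  have := pa (Ordinal ltx); rewrite /= prednK //.
  by case/orP => // /eqP/count_memPn; rewrite xp.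
by case: eqP => //= /eqP; rewrite -lt0n -has_count has_pred1 => /pa.
Qed.

(** The factors [(-1) ^+ j] multiply to the sign of the number of parts, and the boolean kills every
    positive multiplicity of a multiple of [l]. *)
Lemma b_diff_coef (l n : nat) :
  (b_even l n)%:Z - (b_odd l n)%:Z =
  (\prod_(i < n) \sum_(j < n.+1)
     ((-1) ^+ j * ((j == 0%N :> nat) || ~~ (l %| i.+1)%N)%:R) *: 'X^(i.+1 * j))`_n
  :> int.
Proof.
pose w i j : int := (-1) ^+ j * ((j == 0%N) || ~~ (l %| i)%N)%:R.
rewrite -(sum_intpart_coef _ n w) -[Posz (b_even _ _)]natz.
rewrite -[Posz (b_odd _ _)]natz /b_even /b_odd -!sum1dep_card !natr_sum.
rewrite !(big_mkcond (fun p => l_regular _ _ && _)) -sumrB /=.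
apply: eq_bigr => p _; rewrite /w prod_sign_bool.
rewrite (forall_count_mem _ p (fun x => ~~ (l %| x)%N)) -/(l_regular l p).
have -> : (\sum_(i < n) count_mem i.+1 p)%N = size p.
  rewrite (perm_size (perm_seq_of_mults _ p)) -count_predT count_seq_of_mults.
  by apply: eq_bigr => i _; rewrite mul1n.
by rewrite -signr_odd; case: l_regular; case: odd.
Qed.

Lemma mem_residues (l x : nat) :
  (1 < l)%N -> ~~ odd l -> (x %% l \in residues l)%N = odd x || (l %| x)%N.
Proof.
move=> hl hev; rewrite inE mem_filter mem_iota ltn_mod (ltnW hl) andbT orbC.
rewrite -/(dvdn l x); congr (_ || _).
by rewrite andbT [in RHS](divn_eq x l) oddD oddM (negbTE hev) andbF.
Qed.

Lemma uniq_intpart (n : nat) (p : intpart n) :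
  uniq p = [forall i : 'I_n, (count_mem i.+1 p <= 1)%N].
Proof.
apply/idP/forallP => [up i|cnt]; first by rewrite count_uniq_mem // leq_b1.
apply/count_mem_uniq => x; have [xp|/count_memPn //] := boolP (x \in _).
have /andP[x_gt0 x_le] := intpart_bounds _ _ _ xp.
have ltx : (x.-1 < n)%N by rewrite prednK.
have := cnt (Ordinal ltx); rewrite /= prednK // => le1.
by apply/eqP; rewrite eqn_leq le1 -has_count has_pred1.
Qed.

(** The signs [(-1) ^+ (i.+1 * j)] multiply to [(-1) ^+ n]; they carry out the substitution of -q
    for q. *)
Lemma d_coef (l n : nat) : (1 < l)%N -> ~~ odd l ->
  (-1) ^+ n * (d_distinct l n)%:Z =
  (\prod_(i < n) \sum_(j < n.+1)
     ((-1) ^+ (i.+1 * j) *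
      ((j <= 1) && ((j == 0 :> nat) || (odd i.+1 || (l %| i.+1))))%N%:R)
       *: 'X^(i.+1 * j))`_n
  :> int.
Proof.
move=> hl hev.
pose w i j : int := (-1) ^+ (i * j) *
  ((j <= 1) && ((j == 0) || (odd i || (l %| i))))%N%:R.
rewrite -(sum_intpart_coef _ n w) -[Posz (d_distinct _ _)]natz.
rewrite /d_distinct -sum1dep_card natr_sum mulr_sumr.
rewrite big_mkcond; apply: eq_bigr => p _; rewrite /w prod_sign_bool.
have -> : (\sum_(i < n) i.+1 * count_mem i.+1 p)%N = n.
  rewrite -sumn_seq_of_mults -(perm_sumn (perm_seq_of_mults _ p)).
  by case/and3P: (valP p) => _ _ /eqP.
rewrite (_ : [forall i, _] = uniq p && all (fun x => x %% l \in residues l)%N p).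
  by case: (_ && _); rewrite ?mulr0.
rewrite uniq_intpart -forall_count_mem.
apply/forallP/andP => [c|[/forallP c1 /forallP c2] i].
  split; apply/forallP => i; case/andP: (c i) => // _.
  by rewrite mem_residues.
by rewrite c1; have := c2 i; rewrite mem_residues.
Qed.

(** * Congruences modulo X^N and Euler's identity *)

Section Congruence.
Variable N : nat.
Implicit Types p q r : {poly int}.

(* Power series identities are handled as polynomial congruences modulo X^N. *)
Definition eqmodX p q := 'X^N %| p - q.
Local Notation "p ≡ q" := (eqmodX p q) (at level 70).

Lemma eqmodX_refl p : p ≡ p.
Proof. by rewrite /eqmodX subrr dvdp0. Qed.

Lemma eqmodX_sym p q : p ≡ q -> q ≡ p.
Proof. by rewrite /eqmodX -dvdpNr opprB. Qed.

Lemma eqmodX_trans q p r : p ≡ q -> q ≡ r -> p ≡ r.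
Proof. by rewrite /eqmodX => pq qr; rewrite -(subrKA q) dvdp_add. Qed.

Lemma eqmodXM p p' q q' : p ≡ p' -> q ≡ q' -> p * q ≡ p' * q'.
Proof.
rewrite /eqmodX => pp qq.
rewrite (_ : _ - _ = (p - p') * q + p' * (q - q')); last by ring.
by apply: dvdp_add; [apply: dvdp_mulr | apply: dvdp_mull].
Qed.

Lemma eqmodX_prod (I : eqType) (s : seq I) (P : pred I) (F G : I -> {poly int}) :
  (forall i, i \in s -> P i -> F i ≡ G i) ->
  \prod_(i <- s | P i) F i ≡ \prod_(i <- s | P i) G i.
Proof.
move=> FG; rewrite big_seq_cond [X in _ ≡ X]big_seq_cond.
apply: (big_ind2 eqmodX) => [|p p' q q' pp qq|i /andP[]]; last exact: FG.
  exact: eqmodX_refl.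
exact: eqmodXM.
Qed.

(** Over [int], divisibility of polynomials is only up to a scalar, but X^N is monic, so a genuine
    quotient exists. *)
Lemma eqmodX_coef p q k : (k < N)%N -> p ≡ q -> p`_k = q`_k.
Proof.
move=> ltk /(Pdiv.IdomainMonic.dvdpP (monicXn _ _))[r /(congr1 (coefp k))].
rewrite /= coefB coefMXn ltk => /eqP; rewrite subr_eq0 => /eqP //.
Qed.

(** A nonzero constant term makes [c] coprime to X, hence to X^N. *)
Lemma eqmodX_cancel c p q : c.[0] != 0 -> c * p ≡ c * q -> p ≡ q.
Proof.
rewrite /eqmodX -mulrBr => c0; rewrite Gauss_dvdpr //.
by rewrite coprimep_expl // coprimep_sym coprimepX.
Qed.

Lemma eqmodX_1subXn k : (N <= k)%N -> 1 - 'X^k ≡ 1.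
Proof.
move=> leNk; rewrite /eqmodX addrAC subrr add0r dvdpNr.
by rewrite dvdp_exp2l.
Qed.

(** Truncated geometric series in -X^k: the error is, up to sign, X^(kn) with kn at least N. *)
Lemma eqmodX_1addXnM k n : (0 < k)%N -> (N <= n)%N ->
  (1 + 'X^k) * \sum_(j < n) (-1) ^+ j *: 'X^(k * j) ≡ 1.
Proof.
move=> k_gt0 leNn.
have -> : \sum_(j < n) (-1) ^+ j *: 'X^(k * j) =
          \sum_(j < n) (- 'X^k) ^+ j :> {poly int}.
  apply: eq_bigr => j _.
  rewrite [in RHS]exprNn -exprM -[in RHS]signr_odd -signr_odd.
  by case: odd; rewrite ?expr1 ?expr0 ?scaleN1r ?scale1r ?mulN1r ?mul1r.
have -> : 1 + 'X^k = - (- 'X^k - 1) :> {poly int} by ring.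
rewrite mulNr -subrX1 opprB exprNn -exprM.
rewrite /eqmodX addrAC subrr add0r dvdpNr dvdp_mull // dvdp_exp2l //.
by rewrite (leq_trans leNn) // leq_pmull.
Qed.

Lemma euler_distinct_odd :
  (\prod_(1 <= k < N) (1 + 'X^k)) *
  (\prod_(1 <= k < N) (if odd k then 1 - 'X^k else 1)) ≡ 1.
Proof.
pose even_prod n : {poly int} :=
  \prod_(1 <= k < n) (if odd k then 1 else 1 - 'X^k).
(* The even indices below 2n - 1 are the 2k with 1 <= k < n. *)
have even_double n : even_prod n.*2.-1 = \prod_(1 <= k < n) (1 - 'X^(k.*2)).
  rewrite /even_prod; case: n => [|n]; first by rewrite !big_geq.
  elim: n => [|n IHn]; first by rewrite !big_geq.
  rewrite doubleS /= big_nat_recr // big_nat_recr //= IHn /= odd_double /=.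
  by rewrite mulr1 [RHS]big_nat_recr.
(* With E = prod_k (1 - X^k), multiplying by the even-index part of E turns the
   left-hand side into E * prod_k (1 + X^k) = prod_k (1 - X^(2k)), which agrees
   with that even-index part modulo X^N. *)
apply: (@eqmodX_cancel (even_prod N)).
  rewrite /even_prod horner_prod big_seq big1 ?oner_eq0 // => k.
  rewrite mem_index_iota; case: k => [|k] // _; case: ifP => _; rewrite !hornerE //.
  by rewrite expr0n subr0.
have -> : even_prod N * ((\prod_(1 <= k < N) (1 + 'X^k)) *
    (\prod_(1 <= k < N) (if odd k then 1 - 'X^k else 1))) =
    \prod_(1 <= k < N) (1 - 'X^(k.*2)).
  rewrite /even_prod -!big_split /=; apply: eq_bigr => k _.
  by case: ifP => _; rewrite -addnn exprD; ring.
rewrite mulr1 -even_double.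
have [N0|N_gt0] := posnP N; first by rewrite /even_prod N0 !big_geq // eqmodX_refl.
have leN : (N <= N.*2.-1)%N.
  by case: (N) N_gt0 => // m _; rewrite doubleS /= ltnS -addnn leq_addr.
rewrite /even_prod (big_cat_nat N_gt0 leN) /= -[X in _ ≡ X]mulr1.
apply: eqmodXM; first exact: eqmodX_refl.
apply: (@eqmodX_trans (\prod_(N <= k < N.*2.-1) 1)); last first.
  by rewrite big1_eq eqmodX_refl.
apply: eqmodX_prod => k; rewrite mem_index_iota => /andP[leNk _] _.
by case: ifP => _; [apply: eqmodX_refl | apply: eqmodX_1subXn].
Qed.

End Congruence.

(** * Comparison of the two products *)

Theorem theorem1p1 (l : nat) (hl : (1 < l)%N) (hev : ~~ odd l)
    (n : nat) (hn : (0 < n)%N) :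
  (b_even l n)%:Z - (b_odd l n)%:Z = (-1) ^+ n * (d_distinct l n)%:Z.
Proof.
rewrite b_diff_coef d_coef //; apply: (@eqmodX_coef n.+1) => //.
pose P : {poly int} := \prod_(i < n) (1 + 'X^(i.+1)).
pose M : {poly int} := \prod_(i < n) (if (l %| i.+1)%N then 1 + 'X^(i.+1) else 1).
(* [P] has constant term 1. Once multiplied by [P], both sides are congruent to [M]. *)
apply: (@eqmodX_cancel _ P).
  rewrite horner_prod big1 ?oner_eq0 // => i _.
  by rewrite !hornerE expr0n addr0.
apply: (@eqmodX_trans _ M).
  rewrite -big_split /=; apply: eqmodX_prod => i _ _.
  (* If [l] divides the part size, only the term [j = 0] survives and the factor of [P] remains;
     otherwise the geometric series cancels that factor. *)
  case: ifP => li /=.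
    rewrite (bigD1 ord0) //= big1 => [|j /negbTE j0].
      by rewrite muln0 expr0 mul1r scale1r addr0 mulr1 eqmodX_refl.
    by rewrite (val_eqE j ord0) j0 mulr0 scale0r.
  under eq_bigr do rewrite orbT mulr1.
  exact: eqmodX_1addXnM.
apply: eqmodX_sym.
(* Only [j = 0] and [j = 1] contribute. As [l] is even, no odd size is a multiple of [l], so at most
   one of the two factors on the right differs from 1. *)
have D_split (i : 'I_n) : \sum_(j < n.+1) ((-1) ^+ (i.+1 * j) *
      ((j <= 1) && ((j == 0 :> nat) || (odd i.+1 || (l %| i.+1))))%N%:R)
       *: 'X^(i.+1 * j) = (if odd i.+1 then 1 - 'X^(i.+1) else 1) *
    (if (l %| i.+1)%N then 1 + 'X^(i.+1) else 1) :> {poly int}.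
  have n_gt0 : (1 < n.+1)%N by rewrite ltnS.
  rewrite (bigD1 ord0) //= (bigD1 (Ordinal n_gt0)) //= big1 => [|j /andP[]].
    rewrite muln0 !expr0 mul1r scale1r addr0 !muln1 -signr_odd.
    have odd_dvd : (l %| i.+1)%N -> ~~ odd i.+1.
      by case/dvdnP => q ->; rewrite oddM (negbTE hev) andbF.
    move: odd_dvd; rewrite /=; case: (l %| i.+1)%N => [/(_ isT)|_].
      by move/negbTE->; rewrite /= expr0 mul1r scale1r mul1r.
    case: (~~ odd i) => /=; first by rewrite expr1 !mulr1 scaleN1r.
    by rewrite mulr0 scale0r addr0 mulr1.
  case: j => [[|[|j]] ltj] //= _ _.
  by rewrite mulr0 scale0r.
under eq_bigr do rewrite D_split.
(* Euler's identity reduces [P] times the odd factors to 1, which leaves [M]. *)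
rewrite big_split /= mulrA -[X in eqmodX _ _ X]mul1r.
apply: eqmodXM; last exact: eqmodX_refl.
by have := euler_distinct_odd n.+1; rewrite !big_add1 /= !big_mkord.
Qed.
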